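(* Every symplectic Lie algebra $(\mathfrak g,[\cdot,\cdot]_{\mathfrak g},\omega_{\mathfrak g})$ has the structure of a balanced quadratic extension in a canonical way.
   Context: All Lie algebras are real and finite-dimensional. A symplectic Lie algebra $(\mathfrak g,\omega)$ is a Lie algebra $\mathfrak g$ with a skew-symmetric non-degenerate bilinear form $\omega:\mathfrak g\times\mathfrak g\to\mathbb R$ which is closed, i.e. $-\omega([X,Y],Z)+\omega([X,Z],Y)-\omega([Y,Z],X)=0$ for all $X,Y,Z\in\mathfrak g$. An isomorphism of symplectic Lie algebras $(\mathfrak g_1,\omega_1)\to(\mathfrak g_2,\omega_2)$ is a Lie algebra isomorphism $\varphi$ with $\varphi^*\omega_2=\omega_1$. Orthogonal complements ${}^\perp$ are taken with respect to the symplectic form. If $\mathfrak j$ is a central isotropic ideal of a symplectic Lie algebra $\mathfrak g$, then $\mathfrak j^\perp$ is an ideal of $\mathfrak g$ and the symplectic form of $\mathfrak g$ induces a symplectic form on the Lie algebra $\mathfrak j^\perp/\mathfrak j$. A quadratic extension of an abelian Lie algebra $\mathfrak l$ by a symplectic Lie algebra $(\mathfrak a,[\cdot,\cdot]_{\mathfrak a},\omega_{\mathfrak a})$ is a tuple $(\mathfrak g,\mathfrak j,i,p)$, where $\mathfrak g=(\mathfrak g,[\cdot,\cdot]_{\mathfrak g},\omega_{\mathfrak g})$ is a symplectic Lie algebra with center $\mathfrak z$, $\mathfrak j\subset\mathfrak z$ is an ideal of $\mathfrak g$ which is isotropic with respect to $\omega_{\mathfrak g}$, and $i$ and $p$ are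 homomorphisms of Lie algebras forming a short exact sequence $0\to\mathfrak a\xrightarrow{i}\mathfrak g/\mathfrak j\xrightarrow{p}\mathfrak l\to0$ such that $\operatorname{im} i=\mathfrak j^\perp/\mathfrak j$ and $i:\mathfrak a\to\mathfrak j^\perp/\mathfrak j$ is an isomorphism of symplectic Lie algebras. A quadratic extension is called balanced if $\mathfrak j=\mathfrak z\cap\mathfrak z^\perp$. *)

(* Defs.v *)
From HB Require Import structures.
From mathcomp Require Import all_boot all_order all_algebra.
From mathcomp Require Import sesquilinear reals.

Set Implicit Arguments.
Unset Strict Implicit.
Unset Printing Implicit Defensive.
Import Order.TTheory GRing.Theory Num.Theory.
Local Open Scope ring_scope.
Local Open Scope quotient_scope.

Section QuotientVectorSpace.
Variables (K : fieldType) (V : vectType K) (U : {vspace V}).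

(* The library only makes {quot U} an additive group; the vector space
   structure is added here.  Its dimension is obtained from the identification
   of V / U with the complement U^C of U. *)
Definition quotv := Quotient.quot (pred_of_vspace U : zmodClosed V).

HB.instance Definition _ := GRing.Zmodule.on quotv.
HB.instance Definition _ := Quotient.on quotv.

Implicit Types (x y : V) (q r : quotv).

Lemma quotvP x y : reflect (\pi_quotv x = \pi_quotv y) (x - y \in U).
Proof. by rewrite Quotient.idealrBE; apply: eqP. Qed.

Definition quotv_scale (a : K) q : quotv := \pi_quotv (a *: repr q).

Lemma quotv_scale_pi a x : quotv_scale a (\pi_quotv x) = \pi_quotv (a *: x).
Proof.
apply/quotvP; rewrite -scalerBr rpredZ //.
by apply/quotvP; rewrite reprK.
Qed.

Lemma quotv_piD x y : \pi_quotv (x + y) = \pi_quotv x + \pi_quotv y.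
Proof. exact: raddfD. Qed.

Fact quotv_scaleA a b q : quotv_scale a (quotv_scale b q) = quotv_scale (a * b) q.
Proof. by rewrite -[q]reprK (quotv_scale_pi b) !quotv_scale_pi scalerA. Qed.
Fact quotv_scale1 : left_id 1 quotv_scale.
Proof. by move=> q; rewrite -[q]reprK quotv_scale_pi scale1r. Qed.
Fact quotv_scaleDr : right_distributive quotv_scale +%R.
Proof.
move=> a q r; rewrite -[q]reprK -[r]reprK -quotv_piD !quotv_scale_pi.
by rewrite -quotv_piD scalerDr.
Qed.
Fact quotv_scaleDl q : {morph quotv_scale^~ q : a b / a + b}.
Proof. by move=> a b; rewrite -[q]reprK !quotv_scale_pi -quotv_piD scalerDl. Qed.

HB.instance Definition _ := GRing.Zmodule_isLmodule.Build K quotv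
  quotv_scaleA quotv_scale1 quotv_scaleDr quotv_scaleDl.

Fact quotv_pi_is_linear : linear (\pi_quotv : V -> quotv).
Proof. by move=> a x y; rewrite quotv_piD -quotv_scale_pi. Qed.

Let compl x : V := x - projv U x.

Let compl_pi x y : \pi_quotv x = \pi_quotv y -> compl x = compl y.
Proof.
move/quotvP => xyU; apply/eqP; rewrite -subr_eq0 /compl opprD addrACA -opprD.
by rewrite -linearB /= projv_id // subrr.
Qed.

Let compl_id x : x \in (U^C)%VS -> compl x = x.
Proof.
move=> xC; suff: projv U x \in (U :&: U^C)%VS.
  by rewrite capv_compl memv0 /compl => /eqP->; rewrite subr0.
rewrite memv_cap memv_proj /=.
by rewrite -[projv U x](subKr x) rpredB // memv_projC.
Qed.

Fact quotv_vect_iso : Vector.axiom (\dim (U^C)%VS) quotv.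
Proof.
exists (fun q => \row_i coord (vbasis (U^C)%VS) i (compl (repr q))).
  move=> k q r; apply/rowP => i; rewrite !mxE -linearP /=; congr (coord _ _ _).
  rewrite (@compl_pi _ (k *: repr q + repr r)).
    by rewrite /compl linearP /= scalerBr addrACA -opprD.
  by rewrite quotv_pi_is_linear !reprK.
exists (fun c : 'rV_(\dim (U^C)%VS) => \pi_quotv (\sum_i c 0 i *: (vbasis (U^C)%VS)`_i)).
  move=> q; rewrite -[RHS]reprK; apply/quotvP.
  have -> : \sum_i (\row_i0 coord (vbasis (U^C)%VS) i0 (compl (repr q))) 0 i
      *: (vbasis (U^C)%VS)`_i = compl (repr q).
    rewrite [RHS](coord_vbasis (memv_projC U (repr q))).
    by apply: eq_bigr => i _; rewrite mxE.
  by rewrite /compl addrC addKr rpredN memv_proj.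
move=> c; apply/rowP => i; rewrite mxE.
set w := \sum_j _.
have wC : w \in (U^C)%VS.
  by apply: rpred_sum => j _; rewrite rpredZ ?vbasis_mem ?memt_nth.
rewrite (@compl_pi _ w) ?reprK // compl_id //.
by rewrite /w coord_sum_free ?(basis_free (vbasisP _)).
Qed.

HB.instance Definition _ := Lmodule_hasFinDim.Build K quotv quotv_vect_iso.

Definition quotv_proj : 'Hom(V, quotv) := linfun \pi_quotv.

Lemma quotv_projE x : quotv_proj x = \pi_quotv x.
Proof.
pose f := GRing.isLinear.Build K V quotv *:%R _ quotv_pi_is_linear.
pose F : {linear V -> quotv} := HB.pack (\pi_quotv : V -> quotv) f.
exact: (lfunE F).
Qed.

Lemma quotv_proj_repr q : quotv_proj (repr q) = q.
Proof. by rewrite quotv_projE reprK. Qed.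

Lemma quotv_proj_eqP x y : reflect (quotv_proj x = quotv_proj y) (x - y \in U).
Proof. by rewrite !quotv_projE; apply: quotvP. Qed.
End QuotientVectorSpace.

HB.mixin Record isLieAlgebra (R : realType) V of Vector R V := {
  lie : {bilinear V -> V -> V};
  lie_alt : forall x, lie x x = 0;
  lie_jacobi : forall x y z,
    lie x (lie y z) + lie y (lie z x) + lie z (lie x y) = 0
}.

#[short(type="lieAlgType")]
HB.structure Definition LieAlgebra (R : realType) :=
  {V of isLieAlgebra R V & Vector R V}.

Section LieTheory.
Variables (R : realType) (g : lieAlgType R).
Implicit Types x y z : g.

Lemma lie_anti x y : lie x y = - lie y x.
Proof.
apply/eqP; rewrite -subr_eq0 opprK; apply/eqP.
have := lie_alt (x + y).
by rewrite linearDl !linearDr !lie_alt add0r addr0.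
Qed.

Definition ad x : 'End(g) := linfun (lie x).

(* The center {x | forall y, [x, y] = 0} as a vspace, see centerP. *)
Definition center : {vspace g} := lker (linfun ad).

Lemma adE x y : ad x y = lie x y.
Proof. exact: lfunE. Qed.

Fact ad_is_linear : linear ad.
Proof.
move=> a x y; apply/lfunP => z.
by rewrite add_lfunE scale_lfunE !adE linearPl.
Qed.

Lemma centerP x : reflect (forall y, lie x y = 0) (x \in center).
Proof.
pose F : {linear g -> 'End(g)} :=
  HB.pack ad (GRing.isLinear.Build _ _ _ _ _ ad_is_linear).
rewrite memv_ker [linfun ad x](lfunE F) /=.
apply: (iffP eqP) => [ax0 y|ax0]; first by rewrite -adE ax0 zero_lfunE.
by apply/lfunP => y; rewrite adE ax0 zero_lfunE.
Qed.

Definition lie_abelian := forall x y, lie x y = 0.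

Record ideal := Ideal {
  ideal_space :> {vspace g};
  ideal_closed : forall x y, y \in ideal_space -> lie x y \in ideal_space }.

Record subalgebra := Subalgebra {
  subalgebra_space :> {vspace g};
  subalgebra_closed : forall x y, x \in subalgebra_space ->
    y \in subalgebra_space -> lie x y \in subalgebra_space }.
End LieTheory.
Arguments centerP {R g x}.
Arguments center {R} g.
Arguments lie_abelian {R} g.
Arguments ideal {R} g.
Arguments subalgebra {R} g.

Section QuotientLieAlgebra.
Variables (R : realType) (g : lieAlgType R) (j : ideal g).

Definition lie_quot := quotv j.
HB.instance Definition _ := Vector.on lie_quot.

Definition lie_proj : 'Hom(g, lie_quot) := quotv_proj j.

Definition lie_repr (u : lie_quot) : g := repr u.

Lemma lie_reprK u : lie_proj (lie_repr u) = u.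
Proof. exact: quotv_proj_repr. Qed.

Lemma lie_projP x y : reflect (lie_proj x = lie_proj y) (x - y \in j).
Proof. exact: quotv_proj_eqP. Qed.

Definition quot_bracket (u v : lie_quot) : lie_quot :=
  lie_proj (lie (lie_repr u) (lie_repr v)).

Lemma quot_bracketE x y :
  quot_bracket (lie_proj x) (lie_proj y) = lie_proj (lie x y).
Proof.
apply/lie_projP; set x' := lie_repr _; set y' := lie_repr _.
have xx' : x' - x \in j by apply/lie_projP; rewrite lie_reprK.
have yy' : y' - y \in j by apply/lie_projP; rewrite lie_reprK.
have -> : lie x' y' - lie x y = lie x' (y' - y) - lie y (x' - x).
  rewrite !linearBr (lie_anti x y) (lie_anti x' y) !opprK opprB.
  by rewrite addrACA subrr addr0.
by rewrite rpredB // ideal_closed.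
Qed.

Fact quot_bracket_bilinear : bilinear_for *:%R *:%R quot_bracket.
Proof.
split=> w a u v; rewrite -[u]lie_reprK -[v]lie_reprK -[w]lie_reprK.
  by rewrite -linearP !quot_bracketE linearPl linearP.
by rewrite -linearP !quot_bracketE linearPr linearP.
Qed.

HB.instance Definition _ := bilinear_isBilinear.Build R lie_quot lie_quot
  lie_quot *:%R *:%R quot_bracket quot_bracket_bilinear.

Fact quot_bracket_alt u : quot_bracket u u = 0.
Proof. by rewrite -[u]lie_reprK quot_bracketE lie_alt linear0. Qed.

Fact quot_bracket_jacobi u v w : quot_bracket u (quot_bracket v w) +
  quot_bracket v (quot_bracket w u) + quot_bracket w (quot_bracket u v) = 0.
Proof.
rewrite -[u]lie_reprK -[v]lie_reprK -[w]lie_reprK !quot_bracketE -!linearD.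
by rewrite lie_jacobi linear0.
Qed.

HB.instance Definition _ := isLieAlgebra.Build R lie_quot
  quot_bracket_alt quot_bracket_jacobi.

Lemma lie_projM x y : lie_proj (lie x y) = lie (lie_proj x) (lie_proj y).
Proof. by rewrite -quot_bracketE. Qed.
End QuotientLieAlgebra.

Section SubLieAlgebra.
Variables (R : realType) (g : lieAlgType R) (s : subalgebra g).

Definition sub_lie := subvs_of s.
HB.instance Definition _ := Vector.on sub_lie.

Definition sub_val (u : sub_lie) : g := vsval u.
Definition sub_proj (x : g) : sub_lie := vsproj s x.

Lemma sub_bracket_subproof (u v : sub_lie) : lie (sub_val u) (sub_val v) \in s.
Proof. by apply: subalgebra_closed; apply: subvsP. Qed.

Definition sub_bracket (u v : sub_lie) : sub_lie :=
  Subvs (sub_bracket_subproof u v).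

Fact sub_bracket_bilinear : bilinear_for *:%R *:%R sub_bracket.
Proof.
split=> w a u v; apply: subvs_inj; rewrite /= /sub_val.
  by rewrite linearPl.
by rewrite linearPr.
Qed.

HB.instance Definition _ := bilinear_isBilinear.Build R sub_lie sub_lie
  sub_lie *:%R *:%R sub_bracket sub_bracket_bilinear.

Fact sub_bracket_alt u : sub_bracket u u = 0.
Proof. by apply: subvs_inj; apply: lie_alt. Qed.

Fact sub_bracket_jacobi u v w : sub_bracket u (sub_bracket v w) +
  sub_bracket v (sub_bracket w u) + sub_bracket w (sub_bracket u v) = 0.
Proof. by apply: subvs_inj; apply: lie_jacobi. Qed.

HB.instance Definition _ := isLieAlgebra.Build R sub_lie
  sub_bracket_alt sub_bracket_jacobi.
End SubLieAlgebra.

Section Morphisms.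
Variables (R : realType) (g h : lieAlgType R) (f : 'Hom(g, h)).

Definition lie_hom := forall x y, f (lie x y) = lie (f x) (f y).
Definition lie_iso := lie_hom /\ bijective f.
End Morphisms.

HB.mixin Record isSymplectic (R : realType) V of LieAlgebra R V := {
  omega : {skew_symmetric V};
  omega_nondegenerate : nondegenerate omega;
  omega_closed : forall x y z : V,
    - omega (lie x y) z + omega (lie x z) y - omega (lie y z) x = 0
}.

#[short(type="symplecticLieAlgType")]
HB.structure Definition SymplecticLieAlgebra (R : realType) :=
  {V of isSymplectic R V & LieAlgebra R V}.

Section NondegenerateForms.
Variables (K : fieldType) (V : vectType K) (f : {skew_symmetric V}).
Implicit Types (U : {vspace V}) (X : seq V).

Lemma orthovDE U W : orthov f (U + W)%VS = (orthov f U :&: orthov f W)%VS.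
Proof.
by apply: subv_anti; rewrite subv_cap -orthovD subvv /= orthovD capvSl capvSr.
Qed.

Lemma dim_orthov_addv U X :
  (\dim (orthov f U) <= \dim (orthov f (U + <<X>>)) + size X)%N.
Proof.
elim: X U => [|x X IH] U; first by rewrite span_nil addv0 addn0.
rewrite span_cons addvA /= addnS; apply: leq_trans (leqSpred _) _.
rewrite ltnS; apply: leq_trans (IH _); rewrite orthovDE.
exact: leq_dim_orthov1.
Qed.

Lemma dim_orthov U : nondegenerate f ->
  (\dim (orthov f U) + \dim U = \dim {:V})%N.
Proof.
move=> /eqP f0; apply/eqP; rewrite eqn_leq; apply/andP; split.
  have := dim_orthov_addv U (vbasis U^C); rewrite (span_basis (vbasisP _)).
  rewrite addv_complf f0 dimv0 add0n size_tuple dimv_compl.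
  by rewrite -(leq_add2r (\dim U)) subnK // dimvS ?subvf.
have := dim_orthov_addv 0 (vbasis U); rewrite (span_basis (vbasisP _)).
by rewrite add0v orthov0 size_tuple.
Qed.

Lemma orthovK U : nondegenerate f -> orthov f (orthov f U) = U.
Proof.
move=> f_nd; apply/esym/eqP; rewrite eqEdim orthov_sym subvv /=.
rewrite -(leq_add2l (\dim (orthov f U))) addnC dim_orthov //.
by rewrite dim_orthov.
Qed.
End NondegenerateForms.

Section Reduction.
Variables (R : realType) (g : symplecticLieAlgType R).
Implicit Types x y z : g.

Lemma omega_skew x y : omega x y = - omega y x.
Proof. by rewrite hermC /= expr1 mulN1r. Qed.

Record central_isotropic_ideal := CentralIsotropicIdeal {
  cii_ideal :> ideal g;
  cii_central : (cii_ideal <= center g)%VS;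
  cii_isotropic : (cii_ideal <= orthov omega cii_ideal)%VS }.

Variable j : central_isotropic_ideal.

Local Notation perp := (orthov omega (j : {vspace g})).

Fact perp_ideal_closed x y : y \in perp -> lie x y \in perp.
Proof.
move=> /mem_orthovP yj; apply/mem_orthovP => z zj.
have z0 := centerP (subvP (cii_central j) z zj).
have := omega_closed x y z.
rewrite (lie_anti x z) (lie_anti y z) !z0 oppr0 !linear0l subr0 addr0.
by move/eqP; rewrite oppr_eq0 => /eqP.
Qed.

Definition perp_ideal : ideal g := Ideal perp_ideal_closed.

Fact perp_quot_closed (u v : lie_quot j) :
  u \in (lie_proj j @: perp)%VS -> v \in (lie_proj j @: perp)%VS ->
  lie u v \in (lie_proj j @: perp)%VS.
Proof.
move=> /memv_imgP[x _ ->] /memv_imgP[y yp ->]; rewrite -lie_projM.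
by rewrite memv_img // perp_ideal_closed.
Qed.

Definition perp_quot : subalgebra (lie_quot j) := Subalgebra perp_quot_closed.

(* j^perp / j, as a Lie subalgebra of g / j. *)
Definition reduction := sub_lie perp_quot.
HB.instance Definition _ := LieAlgebra.on reduction.

Definition reduction_repr (u : reduction) : g := lie_repr (sub_val u).

Definition reduction_proj (x : g) : reduction := sub_proj perp_quot (lie_proj j x).

Lemma reduction_reprK u : reduction_proj (reduction_repr u) = u.
Proof.
by rewrite /reduction_proj /reduction_repr lie_reprK; exact: vsvalK.
Qed.

Lemma reduction_repr_perp u : reduction_repr u \in perp.
Proof.
have /memv_imgP[x xp xE] := subvsP u.
have : reduction_repr u - x \in j by apply/lie_projP; rewrite lie_reprK.
move/(subvP (cii_isotropic j)) => d.
by rewrite -[reduction_repr u](subrK x) rpredD.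
Qed.

Lemma val_reduction_proj x : x \in perp -> sub_val (reduction_proj x) = lie_proj j x.
Proof. by move=> xp; rewrite /sub_val vsprojK // memv_img. Qed.

(* Independent of the chosen representatives, see reduced_formE. *)
Definition reduced_form (u v : reduction) : R :=
  omega (reduction_repr u) (reduction_repr v).

Lemma reduced_formE x y : x \in perp -> y \in perp ->
  reduced_form (reduction_proj x) (reduction_proj y) = omega x y.
Proof.
move=> xp yp; rewrite /reduced_form.
set x' := reduction_repr _; set y' := reduction_repr _.
have yp' : y' \in perp by apply: reduction_repr_perp.
have xx' : x' - x \in j.
  by apply/lie_projP; rewrite lie_reprK val_reduction_proj.
have yy' : y' - y \in j.
  by apply/lie_projP; rewrite lie_reprK val_reduction_proj.
have -> : x' = x + (x' - x) by rewrite addrC subrK.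
rewrite linearDl /= (omega_skew (x' - x)) (mem_orthovP yp') // oppr0 addr0.
have -> : y' = y + (y' - y) by rewrite addrC subrK.
by rewrite linearDr /= (mem_orthovP xp _ yy') addr0.
Qed.
End Reduction.

Section ReductionSymplectic.
Variables (R : realType) (g : symplecticLieAlgType R).
Variable j : central_isotropic_ideal g.
Local Notation a := (reduction j).

Lemma reduction_projP (a0 : R) (x y : g) : reduction_proj j (a0 *: x + y) =
  a0 *: reduction_proj j x + reduction_proj j y.
Proof. by rewrite /reduction_proj /sub_proj !linearP. Qed.

Let reprP (u : a) := reduction_repr_perp u.

Fact reduced_form_bilinear : bilinear_for *%R *%R (reduced_form (j := j)).
Proof.
split=> w k u v; rewrite -[u]reduction_reprK -[v]reduction_reprK
  -[w]reduction_reprK -reduction_projP !reduced_formE ?rpredD ?rpredZ ?reprP //.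
  by rewrite linearPl.
by rewrite linearPr.
Qed.

HB.instance Definition _ := bilinear_isBilinear.Build R a a R *%R *%R
  (reduced_form (j := j)) reduced_form_bilinear.

Fact reduced_form_skew (u v : a) :
  reduced_form u v = (-1) ^+ true * idfun (reduced_form v u).
Proof. exact: hermC. Qed.

HB.instance Definition _ := isHermitianSesquilinear.Build R a true idfun
  (reduced_form (j := j)) reduced_form_skew.

Fact reduced_form_nondegenerate :
  nondegenerate (reduced_form (j := j) : {skew_symmetric a}).
Proof.
apply/eqP/vspaceP => u; rewrite memv0; apply/idP/eqP; last first.
  by move->; apply: mem0v.
move=> /mem_orthovP u0; rewrite -[u]reduction_reprK.
have xj : reduction_repr u \in (j : {vspace g}).
  rewrite -(orthovK j (omega_nondegenerate (s := g))).
  apply/mem_orthovP => y yp.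
  by rewrite -(reduced_formE (reprP u) yp) reduction_reprK u0 ?memvf.
have px0 : lie_proj j (reduction_repr u) = 0.
  by rewrite -(linear0 (lie_proj j)); apply/lie_projP; rewrite subr0.
by rewrite /reduction_proj px0 /sub_proj linear0.
Qed.

Fact reduction_projM (x y : g) :
  x \in orthov omega j -> y \in orthov omega j ->
  lie (reduction_proj j x) (reduction_proj j y) = reduction_proj j (lie x y).
Proof.
move=> xp yp; apply: subvs_inj; rewrite -/(sub_val (reduction_proj j (lie x y))).
rewrite val_reduction_proj ?perp_ideal_closed // lie_projM.
by rewrite -!val_reduction_proj.
Qed.

Fact reduced_form_closed (u v w : a) : - reduced_form (lie u v) w +
  reduced_form (lie u w) v - reduced_form (lie v w) u = 0.
Proof.
rewrite -[u]reduction_reprK -[v]reduction_reprK -[w]reduction_reprK.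
rewrite !reduction_projM ?reprP // !reduced_formE ?perp_ideal_closed ?reprP //.
exact: omega_closed.
Qed.

HB.instance Definition _ := isSymplectic.Build R a
  reduced_form_nondegenerate reduced_form_closed.
End ReductionSymplectic.

Section QuadraticExtensions.
Variable R : realType.

Definition symplectic_iso (g h : symplecticLieAlgType R) (f : 'Hom(g, h)) :=
  lie_iso f /\ isometry (omega (s := h)) (omega (s := g)) f.

Section Tuples.
Variables (l : lieAlgType R) (a g : symplecticLieAlgType R).
Variable j : central_isotropic_ideal g.
Variables (i : 'Hom(a, lie_quot j)) (p : 'Hom(lie_quot j, l)).

(* i viewed as a map a -> j^perp / j; sub_proj is the identity on j^perp / j,
   so this is meaningful as soon as limg i = perp_quot j. *)
Definition corestriction : 'Hom(a, reduction j) :=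
  linfun (fun x => sub_proj (perp_quot j) (i x)).

Definition short_exact := [/\ lker i = 0%VS, limg i = lker p & limg p = fullv].

Definition is_quadratic_extension :=
  [/\ lie_abelian l,
      lie_hom i /\ lie_hom p,
      short_exact,
      limg i = perp_quot j &
      symplectic_iso corestriction].

Definition is_balanced :=
  cii_ideal j = (center g :&: orthov omega (center g))%VS :> {vspace g}.
End Tuples.

Section Isomorphisms.
Variables (l : lieAlgType R) (a g : symplecticLieAlgType R).
Variable j : central_isotropic_ideal g.
Variables (i : 'Hom(a, lie_quot j)) (p : 'Hom(lie_quot j, l)).
Variables (l' : lieAlgType R) (a' g' : symplecticLieAlgType R).
Variable j' : central_isotropic_ideal g'.
Variables (i' : 'Hom(a', lie_quot j')) (p' : 'Hom(lie_quot j', l')).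

(* phi_j is the map g / j -> g' / j' induced by phi. *)
Definition extension_iso (phi : 'Hom(g, g')) (phi_a : 'Hom(a, a'))
    (phi_l : 'Hom(l, l')) :=
  [/\ symplectic_iso phi, symplectic_iso phi_a, lie_iso phi_l,
      (phi @: j)%VS = j' &
      exists phi_j : 'Hom(lie_quot j, lie_quot j'),
        [/\ phi_j \o lie_proj j = lie_proj j' \o phi,
            phi_j \o i = i' \o phi_a &
            p' \o phi_j = phi_l \o p]%VF].
End Isomorphisms.
End QuadraticExtensions.

Section CanonicalExtension.
Variables (R : realType) (g : symplecticLieAlgType R).

Definition center_radical : {vspace g} :=
  (center g :&: orthov omega (center g))%VS.

Fact center_radical_ideal x y : y \in center_radical -> lie x y \in center_radical.
Proof.
rewrite memv_cap => /andP[/centerP y0 _].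
by rewrite lie_anti y0 oppr0 mem0v.
Qed.

Fact center_radical_central : (center_radical <= center g)%VS.
Proof. exact: capvSl. Qed.

Fact center_radical_isotropic :
  (center_radical <= orthov omega center_radical)%VS.
Proof.
apply/orthovP => x y; rewrite !memv_cap => /andP[_ /mem_orthovP xz] /andP[yz _].
exact: xz.
Qed.

Definition canonical_j : central_isotropic_ideal g :=
  @CentralIsotropicIdeal R g (Ideal center_radical_ideal)
    center_radical_central center_radical_isotropic.

Definition canonical_a : symplecticLieAlgType R := reduction canonical_j.

Definition canonical_l : lieAlgType R := lie_quot (perp_ideal canonical_j).

Definition canonical_i : 'Hom(canonical_a, lie_quot canonical_j) :=
  linfun (@sub_val R (lie_quot canonical_j) (perp_quot canonical_j)).

(* The projection g / j -> g / j^perp, x + j |-> x + j^perp; it does not depend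
   on the representative because j is contained in j^perp. *)
Definition canonical_p : 'Hom(lie_quot canonical_j, canonical_l) :=
  linfun (fun u => lie_proj (perp_ideal canonical_j) (lie_repr u)).
End CanonicalExtension.

(* Main.v *)
(* With z the center and j = z \cap z^\perp, closedness of omega and centrality of
   j give [g, g] \subset j^\perp, so that l = g / j^\perp is abelian; i is the
   inclusion of j^\perp / j and p the projection g / j -> g / j^\perp.
   Canonicity: an isomorphism of symplectic Lie algebras maps centers to centers
   and orthogonals to orthogonals, hence j to j and j^\perp to j^\perp, and so
   descends to all the quotients involved. *)
Require Import Defs.
From HB Require Import structures.
From mathcomp Require Import all_boot all_order all_algebra.
From mathcomp Require Import sesquilinear reals.

Set Implicit Arguments.
Unset Strict Implicit.
Unset Printing Implicit Defensive.
Import GRing.Theory.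
Local Open Scope ring_scope.

(** For functions defined through chosen representatives: their linearity has to be proved,
    sometimes under a hypothesis. *)
Lemma linfunE (K : fieldType) (U V : vectType K) (f : U -> V) :
  linear f -> linfun f =1 f.
Proof.
move=> f_lin.
pose F : {linear U -> V} := HB.pack f (GRing.isLinear.Build _ _ _ _ f f_lin).
exact: (lfunE F).
Qed.

(** Provides the inverse as an element of ['Hom], so that it can in turn be passed to quotients. *)
Lemma lfun_bij_inv (K : fieldType) (U V : vectType K) (f : 'Hom(U, V)) :
  bijective f -> exists2 h : 'Hom(V, U), cancel f h & cancel h f.
Proof.
case=> h fK hK.
have hE : linfun h =1 h by apply: linfunE; exact: can2_linear fK hK.
by exists (linfun h) => x; rewrite hE.
Qed.

(** * Images of centers and orthogonals under isomorphisms *)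

Section LieIso.
Variables (R : realType) (g h : lieAlgType R) (f : 'Hom(g, h)).

Lemma limg_center : lie_iso f -> (f @: center g)%VS = center h.
Proof.
case=> fM /lfun_bij_inv[k fK kK]; apply/vspaceP => y; apply/memv_imgP/idP.
  case=> x /centerP x0 ->; apply/centerP => z.
  by rewrite -[z]kK -fM x0 linear0.
move=> /centerP y0; exists (k y); last by rewrite kK.
apply/centerP => z; apply: (can_inj fK).
by rewrite fM kK y0 linear0.
Qed.
End LieIso.

Section SymplecticIso.
Variables (R : realType) (g h : symplecticLieAlgType R) (f : 'Hom(g, h)).

Lemma limg_orthov (U : {vspace g}) : symplectic_iso f ->
  (f @: orthov omega U)%VS = orthov omega (f @: U)%VS.
Proof.
case=> -[_ /lfun_bij_inv[k fK kK]] f_isom.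
apply/vspaceP => y; apply/memv_imgP/mem_orthovP.
  by case=> x /mem_orthovP xU -> _ /memv_imgP[z zU ->]; rewrite f_isom xU.
move=> yU; exists (k y); last by rewrite kK.
by apply/mem_orthovP => z zU; rewrite -f_isom kK yU // memv_img.
Qed.

(** Center and orthogonal are both preserved, and injectivity of [f] lets the image commute with
    their intersection. *)
Lemma limg_canonical_j : symplectic_iso f ->
  (f @: canonical_j g)%VS = canonical_j h.
Proof.
move=> f_iso; case: (f_iso) => f_lie _; rewrite /= /center_radical.
rewrite lker0_img_cap ?limg_orthov ?limg_center //.
by case: f_lie => _ /bij_inj f_inj; apply/lker0P.
Qed.
End SymplecticIso.

(** * Maps induced on quotient Lie algebras *)

Section QuotientLift.
Variables (R : realType) (g : lieAlgType R) (I : ideal g).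

(** Total in [f]; it is known to be the induced map when [I] lies in the kernel of [f]. *)
Definition quot_lift (V : vectType R) (f : 'Hom(g, V)) : 'Hom(lie_quot I, V) :=
  linfun (fun u => f (lie_repr u)).

Lemma quot_liftE (V : vectType R) (f : 'Hom(g, V)) x :
  (I <= lker f)%VS -> quot_lift f (lie_proj I x) = f x.
Proof.
move=> /subvP If.
(* Independence of the representative gives both the value and the linearity required by
   [linfunE]. *)
have fE y z : lie_proj I y = lie_proj I z -> f y = f z.
  move=> /lie_projP/If; rewrite memv_ker linearB subr_eq0.
  by move/eqP.
rewrite [LHS]linfunE => [|a u v]; first by apply: fE; rewrite lie_reprK.
by rewrite -[RHS]linearP; apply: fE; rewrite linearP /= !lie_reprK.
Qed.

Lemma lker_lie_proj : lker (lie_proj I) = I.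
Proof.
apply/vspaceP => x; rewrite memv_ker -(linear0 (lie_proj I)).
by apply/eqP/idP => [/lie_projP|xI]; [|apply/lie_projP]; rewrite subr0.
Qed.

Lemma limg_lie_proj : limg (lie_proj I) = fullv.
Proof.
by apply/vspaceP => u; rewrite memvf -[u]lie_reprK memv_img ?memvf.
Qed.

End QuotientLift.

Section QuotientMaps.
Variables (R : realType) (g h : lieAlgType R) (I : ideal g) (J : ideal h).

Definition quot_map (f : 'Hom(g, h)) : 'Hom(lie_quot I, lie_quot J) :=
  quot_lift I (lie_proj J \o f)%VF.

Lemma quot_mapE (f : 'Hom(g, h)) x :
  (f @: I <= J)%VS -> quot_map f (lie_proj I x) = lie_proj J (f x).
Proof.
move=> fIJ; rewrite quot_liftE ?comp_lfunE //.
apply/subvP => y yI; rewrite memv_ker comp_lfunE -memv_ker lker_lie_proj.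
exact/(subvP fIJ)/memv_img.
Qed.

Lemma quot_map_hom (f : 'Hom(g, h)) :
  (f @: I <= J)%VS -> lie_hom f -> lie_hom (quot_map f).
Proof.
move=> fIJ fM u v; rewrite -[u]lie_reprK -[v]lie_reprK -lie_projM !quot_mapE //.
by rewrite fM lie_projM.
Qed.
End QuotientMaps.

Lemma limg_cancel (K : fieldType) (U V : vectType K) (f : 'Hom(U, V))
    (k : 'Hom(V, U)) (W : {vspace U}) :
  cancel f k -> (k @: (f @: W))%VS = W.
Proof.
move=> fK; rewrite -limg_comp -[RHS]lim1g; congr (_ @: _)%VS.
by apply/lfunP => x; rewrite comp_lfunE id_lfunE fK.
Qed.

(** Since the image of [I] is all of [J], the inverse of [f] maps [J] into [I] and descends too; the
    two induced maps are mutually inverse. *)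
Lemma quot_map_iso (R : realType) (g h : lieAlgType R) (I : ideal g)
    (J : ideal h) (f : 'Hom(g, h)) :
  lie_iso f -> (f @: I)%VS = J -> lie_iso (quot_map I J f).
Proof.
move=> [fM /lfun_bij_inv[k fK kK]] fIJ.
have kJI : (k @: J <= I)%VS by rewrite -fIJ limg_cancel.
have fIJ' : (f @: I <= J)%VS by rewrite fIJ.
split; first exact: quot_map_hom.
by exists (quot_map J I k) => u; rewrite -[u]lie_reprK !quot_mapE ?fK ?kK.
Qed.

(** * Maps induced on the reductions [j^perp / j] *)

Section ReductionMaps.
Variables (R : realType) (g h : symplecticLieAlgType R).
Variables (j : central_isotropic_ideal g) (k : central_isotropic_ideal h).

Definition reduction_map (f : 'Hom(g, h)) : 'Hom(reduction j, reduction k) :=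
  linfun (fun u => reduction_proj k (f (reduction_repr u))).

(** [reduction_proj] is total, but it is on [j^perp] that its value is known to be the class of
    [x]. *)
Lemma reduction_mapE (f : 'Hom(g, h)) x :
  (f @: j <= k)%VS -> x \in orthov omega j ->
  reduction_map f (reduction_proj j x) = reduction_proj k (f x).
Proof.
move=> /subvP fjk xj.
have fE y z : lie_proj j y = lie_proj j z ->
    reduction_proj k (f y) = reduction_proj k (f z).
  move=> /lie_projP yz; congr sub_proj; apply/lie_projP; rewrite -linearB.
  exact/fjk/memv_img.
rewrite [LHS]linfunE.
  by apply: fE; rewrite lie_reprK val_reduction_proj.
move=> a u v; rewrite -reduction_projP -linearP; apply: fE.
by rewrite linearP /= !lie_reprK.
Qed.
End ReductionMaps.

Lemma reduction_map_iso (R : realType) (g h : symplecticLieAlgType R)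
    (j : central_isotropic_ideal g) (k : central_isotropic_ideal h)
    (f : 'Hom(g, h)) :
  symplectic_iso f -> (f @: j)%VS = k -> symplectic_iso (reduction_map j k f).
Proof.
move=> f_iso fjk; have [[fM /lfun_bij_inv[e fK eK]] f_isom] := f_iso.
have fP : (f @: orthov omega j)%VS = orthov omega k by rewrite limg_orthov // fjk.
(* The inverse [e] must preserve the orthogonals as well, to induce the inverse map on the
   reductions. *)
have eP y : y \in orthov omega k -> e y \in orthov omega j.
  by move=> yk; rewrite -(limg_cancel (orthov omega j) fK) memv_img // fP.
have {}fP x : x \in orthov omega j -> f x \in orthov omega k.
  by move=> xj; rewrite -fP memv_img.
have fjk' : (f @: j <= k)%VS by rewrite fjk.
have ekj : (e @: k <= j)%VS by rewrite -fjk limg_cancel.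
have rP := @reduction_repr_perp R.
split; [split|] => [u v||u v].
- rewrite -[u]reduction_reprK -[v]reduction_reprK reduction_projM ?rP //.
  by rewrite !reduction_mapE ?perp_ideal_closed ?rP // reduction_projM ?fP ?rP // fM.
- exists (reduction_map k j e) => u; rewrite -[u]reduction_reprK.
    by rewrite !reduction_mapE ?fP ?rP // fK.
  by rewrite !reduction_mapE ?eP ?rP // eK.
- rewrite -[u]reduction_reprK -[v]reduction_reprK !reduction_mapE ?rP //.
  by rewrite [LHS]reduced_formE ?fP ?rP // [RHS]reduced_formE ?rP ?f_isom.
Qed.

(** * The canonical quadratic extension *)

Section CanonicalExtension.
Variables (R : realType) (g : symplecticLieAlgType R).

Lemma canonical_iE u : canonical_i g u = sub_val u.
Proof. by apply: linfunE => a v w; exact: linearP. Qed.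

Lemma canonical_j_perp :
  (canonical_j g <= lker (lie_proj (perp_ideal (canonical_j g))))%VS.
Proof. by rewrite lker_lie_proj; exact: cii_isotropic. Qed.

(** [canonical_p] unfolds to [quot_lift] of the projection modulo [j^perp], which kills [j] because
    [j] is isotropic. *)
Lemma canonical_pE x :
  canonical_p g (lie_proj (canonical_j g) x) = lie_proj (perp_ideal (canonical_j g)) x.
Proof. exact: quot_liftE canonical_j_perp. Qed.

(* For z in j, both terms of the closedness identity containing a bracket with
   z vanish because z is central, leaving omega [x, y] z = 0. *)
Lemma lie_mem_perp (j : central_isotropic_ideal g) (x y : g) :
  lie x y \in orthov omega j.
Proof.
apply/mem_orthovP => z zj; have z0 := centerP (subvP (cii_central j) z zj).
have := omega_closed x y z.
rewrite (lie_anti x z) (lie_anti y z) !z0 oppr0 !linear0l subr0 addr0.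
by move/eqP; rewrite oppr_eq0 => /eqP.
Qed.

Lemma canonical_l_abelian : lie_abelian (canonical_l g).
Proof.
move=> u v; rewrite -[u]lie_reprK -[v]lie_reprK -lie_projM.
apply/eqP; rewrite -memv_ker lker_lie_proj; exact: lie_mem_perp.
Qed.

Lemma canonical_quadratic_extension :
  is_quadratic_extension (canonical_i g) (canonical_p g).
Proof.
have imi : limg (canonical_i g) = perp_quot (canonical_j g).
  apply/vspaceP => u; apply/memv_imgP/idP => [[v _ ->]|uP].
    by rewrite canonical_iE; exact: subvsP.
  by exists (Subvs uP); rewrite ?memvf ?canonical_iE.
split=> //.
- exact: canonical_l_abelian.
- split=> [u v|u v]; first by rewrite !canonical_iE.
  by rewrite -[u]lie_reprK -[v]lie_reprK -lie_projM !canonical_pE lie_projM.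
- split.
  + by apply/eqP/lker0P => u v; rewrite !canonical_iE; exact: subvs_inj.
  + rewrite imi; apply/vspaceP => u; rewrite -[u]lie_reprK memv_ker canonical_pE.
    rewrite -memv_ker lker_lie_proj; apply/memv_imgP/idP => [[x xP /lie_projP]|].
      (* The chosen representative differs from [x] by an element of [j], hence of [j^perp]. *)
      move/(subvP (cii_isotropic _)) => ux.
      by rewrite -(subrK x (lie_repr u)) rpredD.
    by exists (lie_repr u).
  + apply/vspaceP => u; rewrite memvf -[u]lie_reprK -canonical_pE.
    by rewrite memv_img ?memvf.
(* As [canonical_a] is [j^perp / j] itself, corestricting the inclusion gives the identity. *)
have cE : corestriction (canonical_i g) =1 id.
  move=> u; rewrite [LHS]linfunE => [|a v w]; last by rewrite /sub_proj !linearP.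
  rewrite canonical_iE; exact: vsvalK.
split; [split|] => [u v||u v]; rewrite ?cE //.
by exists id => u; rewrite /= cE.
Qed.

End CanonicalExtension.

(** All the maps are induced by [f], so each square commutes because it does on representatives in
    [g]. *)
Lemma canonical_extension_iso (R : realType) (g h : symplecticLieAlgType R)
    (f : 'Hom(g, h)) :
  symplectic_iso f ->
  extension_iso (canonical_i g) (canonical_p g) (canonical_i h) (canonical_p h)
    f (reduction_map (canonical_j g) (canonical_j h) f)
    (quot_map (perp_ideal (canonical_j g)) (perp_ideal (canonical_j h)) f).
Proof.
move=> f_iso; have [f_lie _] := f_iso.
have fj := limg_canonical_j f_iso.
have fjs : (f @: canonical_j g <= canonical_j h)%VS by rewrite fj.
have fP : (f @: perp_ideal (canonical_j g))%VS = perp_ideal (canonical_j h).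
  by rewrite [LHS]limg_orthov // fj.
have fPs : (f @: perp_ideal (canonical_j g) <= perp_ideal (canonical_j h))%VS.
  by rewrite fP.
split=> //; [exact: reduction_map_iso | exact: quot_map_iso |].
exists (quot_map (canonical_j g) (canonical_j h) f); split; apply/lfunP => u.
- by rewrite !comp_lfunE quot_mapE.
- rewrite !comp_lfunE !canonical_iE -[u]reduction_reprK.
  have uP := reduction_repr_perp u.
  have fuP : f (reduction_repr u) \in orthov omega (canonical_j h).
    by apply: (subvP fPs); rewrite memv_img.
  by rewrite reduction_mapE // !val_reduction_proj ?quot_mapE.
- by rewrite !comp_lfunE -[u]lie_reprK quot_mapE // !canonical_pE quot_mapE.
Qed.

Theorem theorem1 (R : realType) (g : symplecticLieAlgType R) :
  [/\ is_quadratic_extension (canonical_i g) (canonical_p g),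
      is_balanced (canonical_j g) &
      forall (g' : symplecticLieAlgType R) (phi : 'Hom(g, g')),
        symplectic_iso phi ->
        exists (phi_a : 'Hom(canonical_a g, canonical_a g'))
               (phi_l : 'Hom(canonical_l g, canonical_l g')),
          extension_iso (canonical_i g) (canonical_p g)
                        (canonical_i g') (canonical_p g') phi phi_a phi_l].
Proof.
(* Balancedness holds by the very definition of [canonical_j]. *)
split=> [||h f f_iso]; [exact: canonical_quadratic_extension | by [] |].
eexists; eexists; exact: canonical_extension_iso f_iso.
Qed.
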